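(* The following hold. (1) For all integers $n,r,s\ge 1$ and all even integers $k\ge 1$, $\bar{b}^k_{r,s}(n)\equiv 0\pmod{4}$. (2) For all integers $n,r,s\ge 1$ and all odd integers $k\ge 1$, \[ \bar{b}^k_{r,s}(n)\equiv \begin{cases} 2s\pmod 4, & \text{if } n=\ell^2 \text{ for some integer } \ell\ge 1,\\ 2(r+s)\pmod 4, & \text{if } n=2\ell^2 \text{ for some integer } \ell\ge 1,\\ 0 \pmod 4, & \text{otherwise}. \end{cases} \]
   Context: Write $f_m=\prod_{i\ge 1}(1-q^{mi})$ for $m\ge 1$, and $f_m^a$ for its $a$-th power. For integers $r,s,k\ge 1$, $\bar{b}^k_{r,s}(n)$ denotes the number of overcolored partition $k$-tuples of $n$: $k$-tuples of partitions of total weight $n$ in which each even part may appear in one of $r$ colors, each odd part may appear in one of $s$ colors, and the first occurrence of each part (of each color) in each component may be overlined. Equivalently, as formal power series in $q$, \[\sum_{n=0}^{\infty}\bar{b}^k_{r,s}(n)q^n=\frac{f_2^{(3s-2r)k}}{f_1^{2sk}f_4^{(s-r)k}}.\] *)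

(* Defs.v *)
From mathcomp Require Import all_boot.

Set Implicit Arguments.
Unset Strict Implicit.
Unset Printing Implicit Defensive.

Definition num_colors (r s m : nat) : nat := if odd m then s else r.

(* Colored parts of size at most n. The first component i : 'I_n stands for
   the part size i.+1, so that sizes range over 1, ..., n. *)
Definition colored_part (n r s : nat) : finType :=
  {i : 'I_n & 'I_(num_colors r s i.+1)}.

Definition part_size (n r s : nat) (p : colored_part n r s) : nat :=
  (tag p).+1.

(* A partition into colored parts, given by the multiplicity of each colored
   part, together with the set of those colored parts whose first occurrence
   is overlined. Bounding sizes and multiplicities by n loses nothing, since
   only partitions of weight at most n are ever counted. *)
Definition marked_multiset (n r s : nat) : finType :=
  ({ffun colored_part n r s -> 'I_n.+1} * {set colored_part n r s})%type.

(* Only a part that occurs can have its first occurrence overlined. *)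
Definition overcolored_partition (n r s : nat) (x : marked_multiset n r s) :
    bool :=
  [forall p in x.2, 0 < x.1 p].

Definition weight (n r s : nat) (x : marked_multiset n r s) : nat :=
  \sum_(p : colored_part n r s) x.1 p * part_size p.

Definition overcolored_partition_tuples (k r s n : nat) :
    {set {ffun 'I_k -> marked_multiset n r s}} :=
  [set x : {ffun 'I_k -> marked_multiset n r s}
     | [forall j, overcolored_partition (x j)]
       && (\sum_(j < k) weight (x j) == n)].

Definition bbar (k r s n : nat) : nat := #|overcolored_partition_tuples k r s n|.

(* Main.v *)
(* A choice of multiplicities with [t] distinct parts (counted with color and
   component) can be overlined in [2 ^ t] ways. Modulo 4 only [t = 1] matters:
   a single part of size [d], repeated [n / d] times, in one of [k] components.
   Hence [bbar k r s n] is congruent to [2 k] times the sum over the divisors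
   [d] of [n] of the number of colors of [d], and only the parity of that sum
   counts. The number of divisors of [n] is odd iff [n] is a square, and the
   even divisors of [n] correspond to the divisors of [n / 2], so their number
   is odd iff [n] is twice a square. *)

Require Import Defs.
From mathcomp Require Import all_boot.

Set Implicit Arguments.
Unset Strict Implicit.
Unset Printing Implicit Defensive.

Lemma perm_codivisors n : 0 < n ->
  perm_eq [seq n %/ d | d <- divisors n] (divisors n).
Proof.
move=> n_gt0; have n_neq0 : n != 0 by rewrite -lt0n.
have codivK : {in divisors n, cancel (fun d => n %/ d) (fun d => n %/ d)}.
  move=> d; rewrite -dvdn_divisors // => /dvdnP[e def_n]; move: n_gt0.
  by rewrite def_n muln_gt0 => /andP[e_gt0 d_gt0]; rewrite mulnK // mulKn.
apply: uniq_perm (divisors_uniq n) _.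
  by rewrite map_inj_in_uniq ?divisors_uniq //; apply: can_in_inj codivK.
move=> d; apply/mapP/idP => [[e e_n ->] | d_n].
  by rewrite -!dvdn_divisors // in e_n *; apply: dvdn_div.
exists (n %/ d); last by rewrite codivK.
by rewrite -!dvdn_divisors // in d_n *; apply: dvdn_div.
Qed.

(* Pairing each divisor [d] with [n %/ d] leaves only the square root of [n]. *)
Lemma odd_size_divisorsP n : 0 < n ->
  reflect (exists2 l, 0 < l & n = l ^ 2) (odd (size (divisors n))).
Proof.
move=> n_gt0.
pose lo d := d * d < n; pose hi d := n < d * d; pose mid d := d * d == n.
have lo_hi : count lo (divisors n) = count hi (divisors n).
  rewrite -(permP (perm_codivisors n_gt0) lo) count_map.
  apply: eq_in_count => d; rewrite -dvdn_divisors // => /dvdnP[e def_n].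
  have d_gt0 : 0 < d by move: n_gt0; rewrite def_n muln_gt0 => /andP[].
  have e_gt0 : 0 < e by move: n_gt0; rewrite def_n muln_gt0 => /andP[].
  by rewrite /= /lo /hi def_n mulnK // ltn_pmul2l // ltn_pmul2r.
have -> : size (divisors n) = (count lo (divisors n)).*2 + count mid (divisors n).
  rewrite -addnn {2}lo_hi -(count_predT (divisors n)).
  elim: (divisors n) => //= d ds ->; rewrite /lo /hi /mid.
  by case: ltngtP => _ /=; rewrite ?addnS ?addSn ?add0n ?addnS.
rewrite oddD odd_double /=.
apply: (iffP idP) => [|[l l_gt0 def_n]].
  case: (boolP (has mid (divisors n))) => [/hasP[l _ /eqP def_n] _ |].
    by exists l; [move: n_gt0; rewrite -def_n muln_gt0 => /andP[] | rewrite -mulnn].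
  by rewrite has_count -eqn0Ngt => /eqP->.
(* Squaring is injective, so [mid] selects only [l], which occurs exactly once among the divisors of
   [l ^ 2]. *)
have -> : count mid (divisors n) = count_mem l (divisors n).
  by apply: eq_count => d; rewrite /mid def_n /= mulnn eqn_exp2r.
by rewrite count_uniq_mem ?divisors_uniq // -dvdn_divisors // def_n dvdn_exp.
Qed.

Lemma count_even_divisors_double n : 0 < n ->
  count (predC odd) (divisors (2 * n)) = size (divisors n).
Proof.
move=> n_gt0; rewrite -size_filter -[RHS](size_map (muln 2)); apply: perm_size.
have n2_gt0 : 0 < 2 * n by rewrite muln_gt0.
apply: uniq_perm.
- by rewrite filter_uniq ?divisors_uniq.
- by rewrite map_inj_uniq ?divisors_uniq // => x y /eqP; rewrite eqn_pmul2l // => /eqP.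
move=> d; rewrite mem_filter -dvdn_divisors //=; apply/andP/mapP => [[]|[e]].
  rewrite -dvdn2 => /dvdnP[e ->]; rewrite mulnC dvdn_pmul2l // => e_n.
  by exists e; rewrite // -dvdn_divisors.
by rewrite -dvdn_divisors // => e_n ->; rewrite oddM dvdn_pmul2l.
Qed.

(** For odd [n] both sides fail; for even [n] the count above reduces the claim to [n./2] being a
    square. *)
Lemma odd_count_even_divisorsP n : 0 < n ->
  reflect (exists2 l, 0 < l & n = 2 * l ^ 2)
          (odd (count (predC odd) (divisors n))).
Proof.
move=> n_gt0; case: (boolP (odd n)) => [n_odd | ].
  have -> : count (predC odd) (divisors n) = 0.
    apply/eqP; rewrite eqn0Ngt -has_count -all_predC; apply/allP => d.
    by rewrite -dvdn_divisors //= => /dvdn_odd->.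
  by apply: ReflectF => -[l _ def_n]; rewrite def_n oddM in n_odd.
move=> n_even; have def_n : n = 2 * n./2 by rewrite mul2n even_halfK.
move: n./2 def_n => m def_n; subst n.
have m_gt0 : 0 < m by move: n_gt0; rewrite muln_gt0.
rewrite count_even_divisors_double //.
apply: (iffP (odd_size_divisorsP m_gt0)) => -[l l_gt0 def_m]; exists l => //.
  by rewrite def_m.
by apply/eqP; rewrite -(eqn_pmul2l (m := 2)) // def_m.
Qed.

Lemma sqr_neq_double_sqr l m : 0 < l -> 0 < m -> l ^ 2 != 2 * m ^ 2.
Proof.
(* The 2-adic valuation is even on the left and odd on the right. *)
move=> l_gt0 m_gt0; apply/eqP => /(congr1 (fun x => odd (logn 2 x))).
by rewrite lognM ?expn_gt0 ?m_gt0 // !lognX oddD !oddM (@logn_prime 2 2).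
Qed.

Lemma sum_num_colors_divisors r s n :
  \sum_(d <- divisors n) num_colors r s d
    = s * count odd (divisors n) + r * count (predC odd) (divisors n).
Proof.
rewrite (bigID odd) /= -!sum1_count !big_distrr /= /num_colors.
by congr (_ + _); apply: eq_bigr => d; [move=> -> | move/negbTE->]; rewrite muln1.
Qed.

Lemma expn2_mod4 t : 0 < t -> 2 ^ t = 2 * (t == 1) %[mod 4].
Proof. by case: t => [|[|t]] // _; rewrite !expnS mulnA modnMr. Qed.

(** Elements are pairs of a component and a part: a part occurring in two components offers two
    independent choices of overlining. *)
Definition multiplicity_support k n (T : finType)
    (f : {ffun 'I_k -> {ffun T -> 'I_n.+1}}) : {set 'I_k * T} :=
  [set u | 0 < f u.1 u.2].

(** When a single pair [(j, p)] is used, the weight condition forces its multiplicity to be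
    [n %/ w p] and [w p] to divide [n]; the component [j] is free, whence the factor [k]. *)
Lemma card_support1 k n (T : finType) (w : T -> nat) :
  0 < n -> (forall p, 0 < w p) ->
  #|[set f : {ffun 'I_k -> {ffun T -> 'I_n.+1}} |
      (\sum_j \sum_p f j p * w p == n) && (#|multiplicity_support f| == 1)]|
    = k * #|[set p | w p %| n]|.
Proof.
move=> n_gt0 w_gt0.
have div_lt p : n %/ w p < n.+1 by rewrite ltnS leq_div.
pose single (u : 'I_k * T) : {ffun 'I_k -> {ffun T -> 'I_n.+1}} :=
  [ffun j => [ffun p => if (j, p) == u then Ordinal (div_lt p) else ord0]].
have supp_single u : w u.2 %| n -> multiplicity_support (single u) = [set u].
  move=> u_n; apply/setP=> -[j p]; rewrite !inE !ffunE /=; move: u_n.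
  by case: eqP => [<- /= p_n|//]; rewrite divn_gt0 // dvdn_leq.
have sum_supp1 (f : {ffun 'I_k -> {ffun T -> 'I_n.+1}}) u :
    multiplicity_support f = [set u] ->
    \sum_j \sum_p f j p * w p = f u.1 u.2 * w u.2.
  move=> supp_f; rewrite pair_big_dep /= (bigD1 u) //= big1 ?addn0 // => v.
  rewrite -in_set1 -supp_f inE -eqn0Ngt => /eqP-> //.
rewrite -[k in RHS]card_ord -cardsT -cardsX.
(* [single] is injective on the admissible pairs because its support gives back the pair. *)
rewrite -(card_in_imset (f := single)); last first.
  move=> u v; rewrite !inE /= => u_n v_n eq_uv; apply: set1_inj.
  by rewrite -!supp_single // eq_uv.
apply: eq_card => f; rewrite inE; apply/andP/imsetP => [[/eqP wf]|[u]].
  move=> /cards1P[u supp_f].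
  have def_n : f u.1 u.2 * w u.2 = n by rewrite -(sum_supp1 f u).
  exists u; first by rewrite !inE /= -def_n dvdn_mull.
  apply/ffunP=> j; apply/ffunP=> p; rewrite !ffunE; apply: val_inj.
  case: eqP => [def_u|/eqP neq_u] /=.
    move: def_n; rewrite -def_u /= => def_n.
    by rewrite -[LHS](mulnK _ (w_gt0 p)) def_n.
  by apply/eqP; rewrite eqn0Ngt; move: neq_u; rewrite -in_set1 -supp_f inE.
rewrite !inE /= => u_n ->; rewrite (sum_supp1 _ u) supp_single ?cards1 //.
by split=> //; rewrite !ffunE -surjective_pairing eqxx /= divnK.
Qed.

(** With the multiplicities fixed, each component independently chooses an arbitrary subset of its
    occurring parts to overline. *)
Lemma card_overcolored_tuples_with_multiplicities k n r s
    (f : {ffun 'I_k -> {ffun colored_part n r s -> 'I_n.+1}}) :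
  #|[set x : {ffun 'I_k -> marked_multiset n r s} |
      [forall j, overcolored_partition (x j)] && ([ffun j => (x j).1] == f)]|
    = 2 ^ #|multiplicity_support f|.
Proof.
pose F j : {set marked_multiset n r s} :=
  setX [set f j] (powerset [set p | 0 < f j p]).
transitivity #|family (fun j => mem (F j))|.
  apply: eq_card => x; rewrite inE; apply/andP/familyP => [[/forallP ox /eqP def_f] j|Fx].
    rewrite !inE -def_f !ffunE eqxx /=; apply/subsetP=> p xp.
    by rewrite inE; apply: (forall_inP (ox j)).
  have xf j : (x j).1 = f j by move: (Fx j); rewrite !inE => /andP[/eqP].
  split; last by apply/eqP/ffunP=> j; rewrite ffunE.
  apply/forallP=> j; apply/forall_inP=> p xp; rewrite xf.
  by move: (Fx j); rewrite !inE => /andP[_ /subsetP/(_ p xp)]; rewrite inE.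
(* The support is split by component, so that the power of 2 becomes a product over [j]. *)
rewrite card_family -sum1dep_card -(pair_big_dep predT (fun j p => 0 < f j p) (fun _ _ => 1)) /=.
rewrite expn_sum foldrE big_map big_enum /=.
by apply: eq_bigr => j _; rewrite cardsX cards1 mul1n card_powerset sum1dep_card.
Qed.

(** The weight ignores overlining, so the tuples can be grouped by their multiplicities. *)
Lemma bbar_sum_multiplicities k r s n :
  bbar k r s n =
    \sum_(f : {ffun 'I_k -> {ffun colored_part n r s -> 'I_n.+1}} |
            \sum_j \sum_p f j p * part_size p == n)
       2 ^ #|multiplicity_support f|.
Proof.
rewrite /bbar -sum1_card.
pose mult (x : {ffun 'I_k -> marked_multiset n r s}) := [ffun j => (x j).1].
have weight_mult (x : {ffun 'I_k -> marked_multiset n r s}) :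
    \sum_j weight (x j) = \sum_j \sum_p mult x j p * part_size p.
  by apply: eq_bigr => j _; rewrite ffunE.
rewrite (partition_big mult (fun f => \sum_j \sum_p f j p * part_size p == n)) /=.
  apply: eq_bigr => f wf; rewrite -card_overcolored_tuples_with_multiplicities.
  rewrite -sum1dep_card; apply: eq_bigl => x; rewrite inE weight_mult -/(mult x).
  by case: (mult x =P f) => [->|_]; rewrite ?andbF // wf !andbT.
by move=> x; rewrite inE weight_mult => /andP[].
Qed.

Lemma card_part_size_dvdn r s n : 0 < n ->
  #|[set p : colored_part n r s | part_size p %| n]|
    = \sum_(d <- divisors n) num_colors r s d.
Proof.
move=> n_gt0; rewrite -sum1dep_card.
transitivity (\sum_(i < n | i.+1 %| n) \sum_(c < num_colors r s i.+1) 1).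
  by rewrite sig_big_dep; apply: eq_bigl => p; rewrite andbT.
under [LHS]eq_bigr do rewrite sum1_card card_ord.
rewrite -(big_mkord (fun i => i.+1 %| n) (fun i => num_colors r s i.+1)).
(* Passes from the index [i < n] to the size [i.+1], which runs over 1, ..., [n] and so meets every
   divisor of [n]. *)
rewrite -(big_add1 _ _ 0 n.+1 (fun d => d %| n) (num_colors r s)) -big_filter.
apply/perm_big/uniq_perm; rewrite ?filter_uniq ?iota_uniq ?divisors_uniq //.
move=> d; rewrite mem_filter mem_index_iota -dvdn_divisors // ltnS.
by case: (boolP (d %| n)) => //= dn; rewrite (dvdn_gt0 n_gt0 dn) (dvdn_leq n_gt0 dn).
Qed.

Lemma bbar_mod4 k r s n : 0 < n ->
  bbar k r s n = 2 * (k * \sum_(d <- divisors n) num_colors r s d) %[mod 4].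
Proof.
move=> n_gt0; rewrite bbar_sum_multiplicities -modn_summ.
rewrite (eq_bigr (fun f => 2 * (#|multiplicity_support f| == 1) %% 4)); last first.
  (* An empty support would contribute [2 ^ 0 = 1], but it has weight 0, which [n_gt0] excludes. *)
  move=> f /eqP wf; apply: expn2_mod4; rewrite lt0n cards_eq0; apply/eqP=> supp0.
  suff n0 : n = 0 by rewrite n0 in n_gt0.
  rewrite -wf big1 // => j _; rewrite big1 // => p _.
  have := in_set0 (j, p); rewrite -supp0 inE /= => /negbT.
  by rewrite -eqn0Ngt => /eqP->.
rewrite modn_summ -big_distrr /= -big_mkcondr /= sum1dep_card card_support1 //.
by rewrite card_part_size_dvdn.
Qed.

Lemma modn4_double m : 2 * m = 2 * odd m %[mod 4].
Proof. by rewrite -!(@muln_modr 2 _ 2) // !modn2 oddb. Qed.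

Theorem theorem1p3 :
  (forall n r s k : nat, 0 < n -> 0 < r -> 0 < s -> 0 < k -> ~~ odd k ->
     bbar k r s n = 0 %[mod 4])
  /\
  (forall n r s k : nat, 0 < n -> 0 < r -> 0 < s -> 0 < k -> odd k ->
     [/\ (exists2 l : nat, 0 < l & n = l ^ 2) ->
           bbar k r s n = 2 * s %[mod 4],
         (exists2 l : nat, 0 < l & n = 2 * l ^ 2) ->
           bbar k r s n = 2 * (r + s) %[mod 4]
       & ~ (exists2 l : nat, 0 < l & n = l ^ 2) ->
         ~ (exists2 l : nat, 0 < l & n = 2 * l ^ 2) ->
           bbar k r s n = 0 %[mod 4]]).
Proof.
split=> n r s k n_gt0 _ _ _ k_odd.
  by rewrite bbar_mod4 // modn4_double oddM (negbTE k_odd).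
have := count_predC odd (divisors n); set o := count odd _ => tau_n.
have sqP := odd_size_divisorsP n_gt0; have dsqP := odd_count_even_divisorsP n_gt0.
have sqNdsq : (exists2 l, 0 < l & n = l ^ 2) ->
    ~ (exists2 l, 0 < l & n = 2 * l ^ 2).
  move=> [l l_gt0 ->] [m m_gt0 /eqP]; exact/negP/sqr_neq_double_sqr.
rewrite bbar_mod4 // modn4_double oddM k_odd /= sum_num_colors_divisors -/o.
rewrite oddD !oddM.
(* The odd divisors are all divisors minus the even ones. Hence for a square only the coefficient
   [s] survives modulo 2, while for twice a square both counts are odd and [r + s] survives. *)
have -> : odd o = odd (size (divisors n)) (+) odd (count (predC odd) (divisors n)).
  by rewrite -tau_n oddD addbK.
split=> [sq|dsq|Nsq Ndsq].
- by rewrite (introT sqP sq) (introF dsqP (sqNdsq sq)) andbT andbF addbF [RHS]modn4_double.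
- have Nsq sq := sqNdsq sq dsq.
  by rewrite (introT dsqP dsq) (introF sqP Nsq) !andbT addbC -oddD [RHS]modn4_double.
by rewrite (introF sqP Nsq) (introF dsqP Ndsq) !andbF.
Qed.
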